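(* For $\mu\in\mathcal P$ and $1\le i\le P$, let $d_{\mu_i}u_{h,\mu}\in V_h$ be the solution of $$a_\mu(d_{\mu_i}u_{h,\mu},v_h)=d_{\mu_i}r^{\mathrm{pr}}_\mu(u_{h,\mu})[v_h]\quad\text{for all }v_h\in V_h,$$ and let $d_{\mu_i}u_{r,\mu}\in V_r^{\mathrm{pr}}$ be the solution of $$a_\mu(d_{\mu_i}u_{r,\mu},v_r)=d_{\mu_i}r^{\mathrm{pr}}_\mu(u_{r,\mu})[v_r]\quad\text{for all }v_r\in V_r^{\mathrm{pr}}.$$ Then $$\|d_{\mu_i}u_{h,\mu}-d_{\mu_i}u_{r,\mu}\|\le\Delta_{d_{\mu_i}\mathrm{pr}}(\mu):=\underline{a_\mu}^{-1}\Big(\gamma_{d_{\mu_i}a_\mu}\Delta_{\mathrm{pr}}(\mu)+\|r^{\mathrm{pr},d_{\mu_i}}_\mu(u_{r,\mu},d_{\mu_i}u_{r,\mu})\|\Big).$$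
   Context: Setting. Let $P\in\mathbb N$, $\mu_{\mathsf a},\mu_{\mathsf b}\in\mathbb R^P$, and $\mathcal P=\{\mu\in\mathbb R^P: \mu_{\mathsf a}\le\mu\le\mu_{\mathsf b}\}$ (componentwise). $V$ is a real Hilbert space with norm $\|\cdot\|$, and $V_h\subset V$ is a finite-dimensional subspace. For each $\mu\in\mathcal P$, $a_\mu:V\times V\to\mathbb R$ is a continuous, coercive, symmetric bilinear form and $l_\mu\in V'$. Both are parameter separable, i.e. finite sums $a_\mu=\sum_{\xi}\theta^a_\xi(\mu)a_\xi$, $l_\mu=\sum_\xi\theta^l_\xi(\mu)l_\xi$ with parameter-independent continuous components, and twice Fréchet differentiable with respect to $\mu$. Notation. $d_{\mu_i}$ is the partial derivative with respect to the $i$-th component of $\mu$; $d_{\mu_i}a_\mu,d_{\mu_i}l_\mu$ are obtained by differentiating the coefficients. $r^{\mathrm{pr}}_\mu(u)[v]=l_\mu(v)-a_\mu(u,v)$ and $d_{\mu_i}r^{\mathrm{pr}}_\mu(u)[v]=d_{\mu_i}l_\mu(v)-d_{\mu_i}a_\mu(u,v)$ (with $u,v$ held fixed, also when evaluated at $\mu$-dependent functions). Sensitivity residual: $r^{\mathrm{pr},d_{\mu_i}}_\mu(u,u')[v]=d_{\mu_i}r^{\mathrm{pr}}_\mu(u)[v]-a_\mu(u',v)$ for $u,u',v\in V_h$. Models. $u_{h,\mu}\in V_h$ solves $a_\mu(u_{h,\mu},v_h)=l_\mu(v_h)$ for all $v_h\in V_h$. $V_r^{\mathrm{pr}}\subset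 V_h$ is a linear subspace (reduced basis space) and $u_{r,\mu}\in V_r^{\mathrm{pr}}$ solves $a_\mu(u_{r,\mu},v_r)=l_\mu(v_r)$ for all $v_r\in V_r^{\mathrm{pr}}$. Norms and constants. Norms of residuals are dual norms in $V_h'$ with respect to $\|\cdot\|$; $\gamma_{d_{\mu_i}a_\mu}$ is the continuity constant of $d_{\mu_i}a_\mu$ on $V_h\times V_h$; $\underline{a_\mu}>0$ is the coercivity constant of $a_\mu$ on $V_h$. $\Delta_{\mathrm{pr}}(\mu)=\underline{a_\mu}^{-1}\|r^{\mathrm{pr}}_\mu(u_{r,\mu})\|$. *)

(* Defs.v *)
From HB Require Import structures.
From mathcomp Require Import all_boot all_order all_algebra.
From mathcomp Require Import sesquilinear.
From mathcomp Require Import all_classical all_reals all_analysis.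

Set Implicit Arguments.
Unset Strict Implicit.
Unset Printing Implicit Defensive.

Import Order.TTheory GRing.Theory Num.Theory.
Import numFieldNormedType.Exports.

Local Open Scope classical_set_scope.
Local Open Scope ring_scope.

Section ParameterSpace.
Variables (R : realType) (P : nat).
Implicit Types (D : set 'rV[R]_P) (f : 'rV[R]_P -> R).

Definition box (mua mub : 'rV[R]_P) : set 'rV[R]_P :=
  [set mu | forall j, mua 0 j <= mu 0 j <= mub 0 j].

(* Frechet differentiability of f on D, relative to D: only the values of f
   and g on D matter, so nothing is assumed outside of a box, and at its
   boundary the derivatives are one-sided.  Entry j of g mu is the j-th partial
   derivative of f at mu; see gradient_within_derive for interior points. *)
Definition gradient_within D f (g : 'rV[R]_P -> 'rV[R]_P) : Prop :=
  forall mu, D mu -> forall nu,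
    f nu = f mu + \sum_j g mu 0 j * (nu 0 j - mu 0 j)
           +o_(nu \near within D (nbhs mu)) (nu - mu).

Lemma gradient_withinP D f g :
  gradient_within D f g <-> (forall mu, D mu -> forall e : R, 0 < e ->
   \forall nu \near mu, D nu ->
    `|f nu - (f mu + \sum_j g mu 0 j * (nu 0 j - mu 0 j))| <= e * `|nu - mu|).
Proof.
split=> H mu Dmu.
  move=> e e0.
  have E := funext (H _ Dmu).
  have [/(_ E) /(_ e e0)] := @eqaddoP _ _ _ _
    (within_filter_on D (nbhs_filter_on mu)) f
    (fun nu => f mu + \sum_j g mu 0 j * (nu 0 j - mu 0 j)) (fun nu => nu - mu).
  by rewrite /= near_withinE.
have [_ E] := @eqaddoP _ _ _ _
  (within_filter_on D (nbhs_filter_on mu)) f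
  (fun nu => f mu + \sum_j g mu 0 j * (nu 0 j - mu 0 j)) (fun nu => nu - mu).
move=> nu; apply: (congr1 (@^~ nu) (E _)) => e e0.
by rewrite /= near_withinE; exact: H.
Qed.

Lemma gradient_within_derive D f g mu i :
  gradient_within D f g -> D° mu -> 'D_('e_i) f mu = g mu 0 i.
Proof.
move=> /gradient_withinP H Dmu.
apply/cvg_lim => //.
apply/cvgrPdist_le => e e0 /=.
have := H mu (nbhs_singleton Dmu) e e0 => He.
have {}He : \forall nu \near mu,
    `|f nu - (f mu + \sum_j g mu 0 j * (nu 0 j - mu 0 j))| <= e * `|nu - mu|.
  by move: He; apply: filterS2 (Dmu) => nu Dnu; apply.
have cv : (fun h : R => h *: ('e_i : 'rV[R]_P) + mu) @ 0^' --> mu.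
  apply: cvg_trans (cvg_app _ (@nbhs_dnbhs _ (0 : R))) _.
  have c : (fun h : R => h *: ('e_i : 'rV[R]_P)) @ 0 --> 0 *: ('e_i : 'rV[R]_P).
    exact: scalel_continuous.
  have := cvgD c (cvg_cst mu).
  rewrite scale0r add0r => cc; exact: cc.
have {}He := cv _ He.
near=> h.
have h0 : h != 0 by near: h; exact: nbhs_dnbhs_neq.
have : `|f (h *: 'e_i + mu) -
    (f mu + \sum_j g mu 0 j * ((h *: 'e_i + mu) 0 j - mu 0 j))|
  <= e * `|h *: ('e_i : 'rV[R]_P) + mu - mu| by near: h; exact: He.
rewrite (bigD1 i) //= big1 => [|j ji]; last first.
  by rewrite !mxE eqxx (negbTE ji) /= mulr0 addrK mulr0.
rewrite !mxE !eqxx /= mulr1 !addrK addr0 => hh.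
rewrite /= distrC.
have -> : h^-1 *: (f (h *: 'e_i + mu) - f mu) - g mu 0 i =
    h^-1 * (f (h *: 'e_i + mu) - (f mu + g mu 0 i * h)).
  rewrite opprD addrA [RHS]mulrDr; congr (_ + _).
  by rewrite mulrN mulrCA mulVf // mulr1.
rewrite normrM normfV ler_pdivrMl ?normr_gt0//.
apply: (le_trans hh); rewrite mulrC ler_wpM2r ?(ltW e0)//.
rewrite normrZ ler_piMr //.
rewrite [leLHS]/Num.norm /= mx_normrE.
apply/bigmax_leP; split => // -[k l] _ /=; rewrite !mxE normr_nat.
by case: (_ && _).
Unshelve. all: by end_near. Qed.

Definition twice_differentiable_within D f (g : 'rV[R]_P -> 'rV[R]_P) : Prop :=
  gradient_within D f g /\
  forall j, exists h, gradient_within D (fun mu => g mu 0 j) h.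

(* The family of i-th partial derivatives of a family of functions with
   gradients g. *)
Definition partials n (g : 'I_n -> 'rV[R]_P -> 'rV[R]_P) (i : 'I_P) :
  'I_n -> 'rV[R]_P -> R := fun q mu => g q mu 0 i.

End ParameterSpace.

Section Forms.
Variables (R : realType) (P : nat) (V : normedModType R).
Implicit Types (W : {pred V}) (A : V -> V -> R) (L : V -> R).

Definition sep_form n (theta : 'I_n -> 'rV[R]_P -> R) (a : 'I_n -> V -> V -> R)
  (mu : 'rV[R]_P) (u v : V) : R := \sum_(q < n) theta q mu * a q u v.

Definition sep_functional n (theta : 'I_n -> 'rV[R]_P -> R) (l : 'I_n -> V -> R)
  (mu : 'rV[R]_P) (v : V) : R := \sum_(q < n) theta q mu * l q v.

Definition form_continuous A : Prop := continuous (fun p : V * V => A p.1 p.2).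

Definition form_coercive A : Prop :=
  exists2 alpha : R, 0 < alpha & forall v, alpha * `|v| ^+ 2 <= A v v.

Definition form_symmetric A : Prop := forall u v, A u v = A v u.

Definition finite_dimensional W : Prop :=
  exists (n : nat) (b : 'I_n -> V),
    forall v, v \in W <-> exists c : 'I_n -> R, v = \sum_(k < n) c k *: b k.

Definition galerkin_solution W A L (u : V) : Prop :=
  u \in W /\ forall v, v \in W -> A u v = L v.

(* The three constants below are suprema and an infimum over nonzero vectors
   of W; for W = 0 these are over the empty set, hence 0. *)
Definition dual_norm W L : R :=
  sup [set `|L v| / `|v| | v in [set v | v \in W /\ v != 0]].

Definition continuity_constant W A : R :=
  sup [set x | exists u v, [/\ u \in W, u != 0, v \in W, v != 0 &
    x = `|A u v| / (`|u| * `|v|)]].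

Definition coercivity_constant W A : R :=
  inf [set A v v / `|v| ^+ 2 | v in [set v | v \in W /\ v != 0]].

Definition residual L A (u v : V) : R := L v - A u v.

Definition sensitivity_residual dL dA A (u u' v : V) : R :=
  residual dL dA u v - A u' v.

Definition Delta_pr W A L (ur : V) : R :=
  (coercivity_constant W A)^-1 * dual_norm W (residual L A ur).

Definition Delta_dpr W A L dA dL (ur dur : V) : R :=
  (coercivity_constant W A)^-1 *
  (continuity_constant W dA * Delta_pr W A L ur
   + dual_norm W (sensitivity_residual dL dA A ur dur)).

End Forms.

(* Main.v *)
Require Import Defs.
From HB Require Import structures.
From mathcomp Require Import all_boot all_order all_algebra.
From mathcomp Require Import sesquilinear.
From mathcomp Require Import all_classical all_reals all_analysis.
From mathcomp Require Import ring.

Set Implicit Arguments.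
Unset Strict Implicit.
Unset Printing Implicit Defensive.

Import Order.TTheory GRing.Theory Num.Theory.
Import numFieldNormedType.Exports.

Local Open Scope classical_set_scope.
Local Open Scope ring_scope.

(* The error e = duh - dur satisfies a(e, v) = r(v) - da(uh - ur, v) on Vh,
   where r is the sensitivity residual at (ur, dur).  Testing with v = e and
   coercivity bound |e| by the dual norm of the right-hand side over the
   coercivity constant; the same estimate for the primal equation bounds
   |uh - ur| by Delta_pr. *)

Section SupInf.
Context {R : realType}.
Implicit Types (E : set R) (C : R).

(** An empty or unbounded set has [sup] equal to 0 by convention, so the sign holds in these cases
    too. *)
Lemma sup_ge0 E : (forall x, E x -> 0 <= x) -> 0 <= sup E.
Proof.
move=> E0; have [hE|/sup_out->//] := pselect (has_sup E).
by have [x Ex] := hE.1; apply: le_trans (E0 _ Ex) (sup_upper_bound hE Ex).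
Qed.

(** The sign of [C] covers the empty set, whose [sup] is 0; this is the case of the constants on the
    zero space. *)
Lemma ge0_ge_sup E C : 0 <= C -> ubound E C -> sup E <= C.
Proof.
by move=> C0 EC; have [->|/set0P E0] := eqVneq E set0;
  [rewrite sup0 | exact: ge_sup].
Qed.

Lemma inf_ge0 E : (forall x, E x -> 0 <= x) -> 0 <= inf E.
Proof.
move=> E0; have [->|/set0P Ene] := eqVneq E set0; first by rewrite inf0.
exact: lb_le_inf.
Qed.

End SupInf.

Section Bounds.
Context {R : realType} {V : normedModType R}.
Implicit Types (W : {pred V}) (A : V -> V -> R) (L : V -> R).

(** Boundedness makes the supremum in [dual_norm] a genuine upper bound: an unbounded set would have
    [sup] equal to 0. [form_bounded] does the same for [continuity_constant]. *)
Definition functional_bounded L : Prop :=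
  exists M : R, forall v, `|L v| <= M * `|v|.

Definition form_bounded A : Prop :=
  exists M : R, forall u v, `|A u v| <= M * (`|u| * `|v|).

Lemma continuous_scalar_bounded (l : {scalar V}) :
  continuous l -> functional_bounded l.
Proof.
move=> lc; have /linear_boundedP := continuous_linear_bounded 0 (lc 0).
(* The bound near +oo holds for all constants strictly above [M], hence for [M + 1]. *)
move=> [M [_ HM]]; exists (M + 1) => v; apply: HM.
by rewrite ltrDl.
Qed.

(** Continuity at the origin gives a radius [d] within which the form is at most 1 in absolute
    value. Scaling nonzero [u] and [v] to norm [d / 2], inside the open ball, and pulling the
    factors out by bilinearity gives the constant [(d / 2) ^- 2]. *)
Lemma continuous_biscalar_bounded (a : {biscalar V}) :
  form_continuous a -> form_bounded a.
Proof.
move=> ac; have /cvgrPdist_le/(_ 1 ltr01) := ac (0, 0).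
move=> /nbhs_ballP[d /= d0 Hd].
have d2 : 0 < d / 2 by rewrite divr_gt0.
have small (x : V) : x != 0 -> ball 0 d ((d / 2 / `|x|) *: x).
  move=> x0; rewrite -ball_normE /ball_ /= sub0r normrN normrZ.
  rewrite ger0_norm ?divr_ge0 ?(ltW d0)//.
  by rewrite divfK ?normr_eq0// ltr_pdivrMr// ltr_pMr// ltr1n.
exists ((d / 2) ^- 2) => u v.
have [->|u0] := eqVneq u 0; first by rewrite linear0l !normr0 mul0r mulr0.
have [->|v0] := eqVneq v 0; first by rewrite linear0r !normr0 !mulr0.
have /= := Hd ((d / 2 / `|u|) *: u, (d / 2 / `|v|) *: v)
  (conj (small _ u0) (small _ v0)).
rewrite linear0l sub0r normrN linearZl_LR linearZr_LR /= !normrM !normfV.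
rewrite !normr_id !(gtr0_norm d0) (gtr0_norm (ltr0n R 2)) => H.
have nu : 0 < `|u| by rewrite normr_gt0.
have nv : 0 < `|v| by rewrite normr_gt0.
rewrite -ler_pdivrMr ?mulr_gt0// -[leRHS]mulr1 ler_pdivlMl ?exprn_gt0//.
suff -> : (d / 2) ^+ 2 * (`|a u v| / (`|u| * `|v|)) =
    d / 2 / `|u| * (d / 2 / `|v| * `|a u v|) by [].
by rewrite invfM; ring.
Qed.

Lemma dual_norm_ge0 W L : 0 <= dual_norm W L.
Proof. by apply: sup_ge0 => _ [v _ <-]; rewrite divr_ge0. Qed.

Lemma le_dual_norm W L v :
  functional_bounded L -> v \in W -> `|L v| <= dual_norm W L * `|v|.
Proof.
move=> [M HM] vW; have [v0|v0] := eqVneq v 0.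
  (* The zero vector is outside the set defining the supremum; there the bound itself forces
     [L 0 = 0]. *)
  by have := HM v; rewrite v0 normr0 !mulr0.
rewrite -ler_pdivrMr ?normr_gt0//; apply: ub_le_sup; last by exists v.
by exists M => _ [w [_ w0] <-]; rewrite ler_pdivrMr ?normr_gt0.
Qed.

Lemma dual_norm_le W L C : 0 <= C ->
  (forall v, v \in W -> `|L v| <= C * `|v|) -> dual_norm W L <= C.
Proof.
move=> C0 HC; apply: ge0_ge_sup => // _ [v [vW v0] <-].
by rewrite ler_pdivrMr ?normr_gt0// HC.
Qed.

Lemma continuity_constant_ge0 W A : 0 <= continuity_constant W A.
Proof.
by apply: sup_ge0 => _ [u [v [_ _ _ _ ->]]]; rewrite divr_ge0// mulr_ge0.
Qed.

Lemma le_continuity_constant W A u v : form_bounded A -> u \in W -> v \in W ->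
  `|A u v| <= continuity_constant W A * (`|u| * `|v|).
Proof.
move=> [M HM] uW vW; have [u0|u0] := eqVneq u 0.
  by have := HM u v; rewrite u0 normr0 mul0r !mulr0.
have [v0|v0] := eqVneq v 0.
  by have := HM u v; rewrite v0 normr0 !mulr0.
rewrite -ler_pdivrMr ?mulr_gt0 ?normr_gt0//; apply: ub_le_sup; last first.
  by exists u, v.
exists M => _ [x [y [_ x0 _ y0 ->]]].
by rewrite ler_pdivrMr ?mulr_gt0 ?normr_gt0//.
Qed.

Lemma coercivity_constant_ge0 W A :
  form_coercive A -> 0 <= coercivity_constant W A.
Proof.
move=> [al al0 Hal].
apply: inf_ge0 => _ [v _ <-]; rewrite divr_ge0 ?exprn_ge0//.
by apply: le_trans (Hal v); rewrite mulr_ge0 ?exprn_ge0 ?(ltW al0).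
Qed.

(** The vector [v] makes the set under the infimum nonempty, so its positive lower bound [al] passes
    to the infimum. *)
Lemma coercivity_constant_gt0 W A v :
  form_coercive A -> v \in W -> v != 0 -> 0 < coercivity_constant W A.
Proof.
move=> [al al0 Hal] vW v0; apply: lt_le_trans al0 _; apply: lb_le_inf.
  by exists (A v v / `|v| ^+ 2); exists v.
by move=> _ [w [_ w0] <-]; rewrite ler_pdivlMr ?exprn_gt0 ?normr_gt0.
Qed.

Lemma coercivity_constant_le W A v : form_coercive A -> v \in W -> v != 0 ->
  coercivity_constant W A * `|v| ^+ 2 <= A v v.
Proof.
move=> [al al0 Hal] vW v0; rewrite -ler_pdivlMr ?exprn_gt0 ?normr_gt0//.
apply: ge_inf; last by exists v.
by exists al => _ [w [_ w0] <-]; rewrite ler_pdivlMr ?exprn_gt0 ?normr_gt0.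
Qed.

Lemma residual_bounded L A u :
  functional_bounded L -> form_bounded A -> functional_bounded (residual L A u).
Proof.
move=> [M HM] [N HN]; exists (M + N * `|u|) => v; rewrite /residual.
by apply: le_trans (ler_normB _ _) _; rewrite mulrDl -mulrA lerD.
Qed.

(* [submodClosed] is a semimodule structure: [rpredB] does not apply to it. *)
Lemma submodClosedB (W : submodClosed V) : {in W &, forall u v, u - v \in W}.
Proof. by move=> u v uW vW; rewrite -scaleN1r rpredD ?rpredZ. Qed.

(* The constants are 0 when W = 0, and 0^-1 = 0, so u = u0 is treated apart. *)
Lemma galerkin_error_le (W : submodClosed V) A L u u0 :
  (forall v, {morph A^~ v : x y / x - y}) ->
  form_bounded A -> form_coercive A -> functional_bounded L ->
  galerkin_solution W A L u -> u0 \in W ->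
  `|u - u0| <= (coercivity_constant W A)^-1 * dual_norm W (residual L A u0).
Proof.
move=> ABl Ab Ac Lb [uW Hu] u0W; have eW : u - u0 \in W by exact: submodClosedB.
have [->|e0] := eqVneq (u - u0) 0.
  by rewrite normr0 mulr_ge0 ?dual_norm_ge0// invr_ge0 coercivity_constant_ge0.
rewrite ler_pdivlMl ?(coercivity_constant_gt0 Ac eW e0)//.
rewrite -(ler_pM2r (x := `|u - u0|)) ?normr_gt0// -mulrA -expr2.
apply: le_trans (coercivity_constant_le Ac eW e0) _.
(* The equation for [u], tested with the error, turns the energy of the error into the residual at
   [u0] applied to the error. *)
rewrite ABl Hu//; apply: le_trans (ler_norm _) _.
exact: (@le_dual_norm W (residual L A u0)) (residual_bounded _ Lb Ab) eW.
Qed.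

End Bounds.

Section Separable.
Context {R : realType} {P : nat} {V : normedModType R}.

Lemma sep_formBl n (theta : 'I_n -> 'rV[R]_P -> R) (a : 'I_n -> {biscalar V})
    mu v : {morph (sep_form theta a mu)^~ v : x y / x - y}.
Proof.
move=> x y; rewrite /sep_form -sumrB; apply: eq_bigr => q _.
by rewrite linearBl mulrBr.
Qed.

(** At fixed [mu] the coefficients are mere scalars, so one statement serves both [a mu] and its
    partial derivative [da i mu], which has the same components. *)
Lemma sep_form_bounded n (theta : 'I_n -> 'rV[R]_P -> R)
    (a : 'I_n -> {biscalar V}) mu :
  (forall q, form_continuous (a q)) -> form_bounded (sep_form theta a mu).
Proof.
move=> ac; have /choice[M HM] := fun q => continuous_biscalar_bounded (ac q).
exists (\sum_q `|theta q mu| * M q) => u v; rewrite mulr_suml.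
apply: le_trans (ler_norm_sum _ _ _) _; apply: ler_sum => q _.
by rewrite normrM -mulrA ler_wpM2l.
Qed.

Lemma sep_functional_bounded n (theta : 'I_n -> 'rV[R]_P -> R)
    (l : 'I_n -> {scalar V}) mu :
  (forall q, continuous (l q)) -> functional_bounded (sep_functional theta l mu).
Proof.
move=> lc; have /choice[M HM] := fun q => continuous_scalar_bounded (lc q).
exists (\sum_q `|theta q mu| * M q) => v; rewrite mulr_suml.
apply: le_trans (ler_norm_sum _ _ _) _; apply: ler_sum => q _.
by rewrite normrM -mulrA ler_wpM2l.
Qed.

End Separable.

Theorem proposition2p11 (R : realType) (P : nat) (mua mub : 'rV[R]_P)
  (V : completeNormedModType R)
  (dotV : {dot V for idfun}) (dotVE : forall v : V, dotV v v = `|v| ^+ 2)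
  (Vh Vr : submodClosed V)
  (Vh_fin : finite_dimensional Vh) (Vr_Vh : {subset Vr <= Vh})
  (na nl : nat)
  (theta_a : 'I_na -> 'rV[R]_P -> R) (dtheta_a : 'I_na -> 'rV[R]_P -> 'rV[R]_P)
  (theta_l : 'I_nl -> 'rV[R]_P -> R) (dtheta_l : 'I_nl -> 'rV[R]_P -> 'rV[R]_P)
  (a_ : 'I_na -> {biscalar V}) (l_ : 'I_nl -> {scalar V})
  (theta_a_diff : forall q,
    twice_differentiable_within (box mua mub) (theta_a q) (dtheta_a q))
  (theta_l_diff : forall q,
    twice_differentiable_within (box mua mub) (theta_l q) (dtheta_l q))
  (a_cont : forall q, form_continuous (a_ q))
  (l_cont : forall q, continuous (l_ q)) :
  let a := sep_form theta_a a_ in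
  let l := sep_functional theta_l l_ in
  let da i := sep_form (partials dtheta_a i) a_ in
  let dl i := sep_functional (partials dtheta_l i) l_ in
  (forall mu, box mua mub mu -> form_symmetric (a mu)) ->
  (forall mu, box mua mub mu -> form_coercive (a mu)) ->
  forall (mu : 'rV[R]_P) (i : 'I_P) (uh ur duh dur : V),
    box mua mub mu ->
    galerkin_solution Vh (a mu) (l mu) uh ->
    galerkin_solution Vr (a mu) (l mu) ur ->
    galerkin_solution Vh (a mu) (residual (dl i mu) (da i mu) uh) duh ->
    galerkin_solution Vr (a mu) (residual (dl i mu) (da i mu) ur) dur ->
    `|duh - dur| <= Delta_dpr Vh (a mu) (l mu) (da i mu) (dl i mu) ur dur.
Proof.
move=> a l da dl _ acoer mu i uh ur duh dur muP Huh Hur Hduh Hdur.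
have ab : form_bounded (a mu) by exact: sep_form_bounded.
have dab : form_bounded (da i mu) by exact: sep_form_bounded.
have lb : functional_bounded (l mu) by exact: sep_functional_bounded.
have dlb : functional_bounded (dl i mu) by exact: sep_functional_bounded.
have urW : ur \in Vh by apply: Vr_Vh; case: Hur.
have durW : dur \in Vh by apply: Vr_Vh; case: Hdur.
have uhW : uh \in Vh by case: Huh.
have c0 := coercivity_constant_ge0 Vh (acoer _ muP).
have e_pr : `|uh - ur| <= Delta_pr Vh (a mu) (l mu) ur.
  exact: galerkin_error_le (sep_formBl _ _ _) ab (acoer _ muP) lb Huh urW.
apply: le_trans (galerkin_error_le (sep_formBl _ _ _) ab (acoer _ muP)
  (residual_bounded _ dlb dab) Hduh durW) _.
rewrite /Delta_dpr ler_wpM2l ?invr_ge0//.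
apply: dual_norm_le => [|v vW].
  (* [Delta_pr] is nonnegative because it dominates a norm by [e_pr]. *)
  by rewrite addr_ge0 ?dual_norm_ge0// mulr_ge0 ?continuity_constant_ge0//
    (le_trans _ e_pr).
(* Replacing [uh] by [ur] in the right-hand side of the sensitivity equation costs exactly the term
   [da i mu (uh - ur) v], controlled by continuity of [da i mu] and [e_pr]. *)
have -> : residual (residual (dl i mu) (da i mu) uh) (a mu) dur v =
    - da i mu (uh - ur) v +
    sensitivity_residual (dl i mu) (da i mu) (a mu) ur dur v.
  rewrite /sensitivity_residual /residual /da sep_formBl.
  by ring.
apply: le_trans (ler_normD _ _) _; rewrite normrN mulrDl lerD//.
  apply: le_trans (le_continuity_constant dab (submodClosedB uhW urW) vW) _.
  by rewrite mulrA ler_wpM2r// ler_wpM2l ?continuity_constant_ge0.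
apply: (@le_dual_norm _ _ Vh (sensitivity_residual _ _ _ ur dur)) vW.
(* The sensitivity residual unfolds to a residual for [a mu] at [dur] whose functional is itself the
   residual of [dl i mu] and [da i mu] at [ur]. *)
exact: residual_bounded (residual_bounded _ dlb dab) ab.
Qed.
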